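(* Let $\ell\ge 0$ and $k,n\ge 1$ be integers such that $1<k<\left\lfloor\frac n2\right\rfloor$, and let $$L_\ell^k(n):=\max_{0\le p\le \ell}\left(\left\lfloor\frac{(p+1)n}{k}\right\rfloor-1+RU_{\ell-p}(k)\right).$$ Then: (i) $L_\ell^k(n)\le RU_\ell^k(n)\le L_\ell^k(n)+\ell+1$. (ii) Furthermore, if $\ell\ge 1$ and $n\ge \max\{k(\ell+5),\ k(\log\log 2k+6),\ k(\log\log 2k+2\log \ell+5)\}$, then $$RU_\ell^k(n)=\left\lfloor\frac{(\ell+1)n}{k}\right\rfloor-1+\left\lceil\log(k+m_{\ell+1})\right\rceil,$$ where $m_{\ell+1}$ is the remainder of $(\ell+1)n$ divided by $k$.
   Context: Rényi–Ulam game (adaptive). The Responder thinks of a number from $\{1,\dots,n\}$ and the Questioner has to find it. In each round the Questioner asks whether the sought number belongs to a chosen subset of $\{1,\dots,n\}$, and the Responder immediately answers YES or NO; the Responder may lie at most $\ell\ge0$ times in total during the game. $RU_\ell(n)$ denotes the minimum number of queries needed for the Questioner to surely find the unknown number (i.e. in the worst case) when he may query arbitrary subsets of $\{1,\dots,n\}$. $RU_\ell^k(n)$ denotes the corresponding minimum number when the Questioner may only query subsets with at most $k\ge1$ elements. $\log$ denotes $\log_2$. *)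

(* Defs.v *)
From mathcomp Require Import all_boot all_order all_algebra.
From mathcomp Require Import boolp classical_sets reals exp.

Set Implicit Arguments.
Unset Strict Implicit.
Unset Printing Implicit Defensive.

(* An adaptive questioning strategy over the search space T, as a decision
   tree: either announce a number, or ask "is it in A ?" and go on with sY
   after YES, with sN after NO. *)
Inductive strategy (T : finType) : Type :=
| Announce of T
| Ask of {set T} & strategy T & strategy T.

Arguments Announce {T}.
Arguments Ask {T}.

Fixpoint all_queries (T : finType) (P : pred {set T}) (s : strategy T) : bool :=
  if s is Ask A sY sN then [&& P A, all_queries P sY & all_queries P sN]
  else true.

(* When the sought number is x and the Responder may still lie at most l times,
   every legal play of s announces x after at most q queries. In the Ask case
   the first conjunct is the truthful answer; the second is the lie, which
   is legal only if l > 0 and leaves l - 1 lies. *)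
Fixpoint wins (T : finType) (q l : nat) (x : T) (s : strategy T) : bool :=
  match s with
  | Announce y => y == x
  | Ask A sY sN =>
    if q is q'.+1 then
      wins q' l x (if x \in A then sY else sN)
      && (if l is l'.+1 then wins q' l' x (if x \in A then sN else sY)
          else true)
    else false
  end.

Definition suffices (T : finType) (P : pred {set T}) (l q : nat) : Prop :=
  exists s : strategy T, all_queries P s /\ forall x : T, wins q l x s.

Definition is_min_queries (T : finType) (P : pred {set T}) (l q : nat) : Prop :=
  suffices P l q /\ forall q', suffices P l q' -> q <= q'.

(* The default value 0 is only taken when no number of queries suffices;
   by RUP and RUkP below this never happens for n, k >= 1. *)
Definition min_queries (T : finType) (P : pred {set T}) (l : nat) : nat :=
  xget 0 [set q | is_min_queries P l q]%classic.

(* The numbers 1, ..., n are represented by 'I_n = {0, ..., n - 1}. *)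
Definition RU (l n : nat) : nat := min_queries (predT : pred {set 'I_n}) l.

Definition RUk (l k n : nat) : nat :=
  min_queries [pred A : {set 'I_n} | #|A| <= k] l.

(* The natural-number subtraction is not truncated when 1 <= k <= n. *)
Definition Lbound (l k n : nat) : nat :=
  \max_(p < l.+1) ((p.+1 * n) %/ k - 1 + RU (l - p) k).

Definition log2 (R : realType) (x : R) : R := (ln x / ln 2)%R.

Section WellDefined.
Variables (T : finType) (P : pred {set T}).

Lemma wins_le q q' l l' (x : T) s :
  q <= q' -> l' <= l -> wins q l x s -> wins q' l' x s.
Proof.
elim: s q q' l l' => [y|A sY IHY sN IHN] [|q] [|q'] l l' //= leq lel /andP[h1 h2].
apply/andP; split; first by case: ifP h1 => _; [apply: IHY | apply: IHN].
case: l' lel => [//|l'] lel; case: l lel h2 {h1} => [//|l] lel.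
by case: ifP => _; [apply: IHN | apply: IHY].
Qed.

Hypothesis P1 : forall x, P [set x].

Lemma suffices_ex (x0 : T) l : exists q, suffices P l q.
Proof.
suff [s [q [aq H]]] : exists s q, all_queries P s /\
    forall x, x \in enum T -> wins q l x s.
  by exists q, s; split=> // x; apply: H; rewrite mem_enum.
elim: (enum T) => [|y c [s' [q' [aq' H']]]].
  by exists (Announce x0), 0; split.
suff key m a b : a + b <= m -> exists s q, all_queries P s /\
    forall x l', x \in y :: c -> l' <= l ->
      (if x == y then l' < b else l' < a) -> wins q l' x s.
  have [s [q [aq H]]] := key _ l.+1 l.+1 (leqnn _).
  by exists s, q; split=> // x xc; apply: H => //; case: ifP.
elim: m a b => [|m IH] a b.
  rewrite leqn0 addn_eq0 => /andP[/eqP-> /eqP->].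
  by exists (Announce x0), 0; split=> // x l' _ _; case: ifP.
case: a => [_|a].
  exists (Announce y), 0; split=> // x l' _ _.
  by case: ifP => // /eqP-> _ /=.
case: b => [_|b leab].
  exists s', q'; split=> // x l' + lel; case: eqP => //.
  by rewrite inE => /eqP/negPf-> /H' h _; apply: wins_le h.
have [|sY [qY [aY HY]]] := IH a b.+1; first by rewrite addnS -addSn -ltnS -addnS.
have [|sN [qN [aN HN]]] := IH a.+1 b; first by rewrite -ltnS -addnS.
exists (Ask [set y] sY sN), (qY + qN).+1.
split=> [|x l' xc lel /=]; first by rewrite /= P1 aY aN.
have w1 l1 : wins qY l1 x sY -> wins (qY + qN) l1 x sY.
  by apply: wins_le => //; exact: leq_addr.
have w2 l1 : wins qN l1 x sN -> wins (qY + qN) l1 x sN.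
  by apply: wins_le => //; exact: leq_addl.
rewrite inE; case: (eqVneq x y) => xy lt.
  apply/andP; split; first by apply/w1/HY => //; rewrite xy eqxx.
  case: l' lel lt => [//|l'] lel lt; apply/w2/HN => //; first exact: ltnW.
  by rewrite xy eqxx.
apply/andP; split; first by apply/w2/HN => //; rewrite (negPf xy).
case: l' lel lt => [//|l'] lel lt; apply/w1/HY => //; first exact: ltnW.
by rewrite (negPf xy).
Qed.

Lemma min_queriesP (x0 : T) l : is_min_queries P l (min_queries P l).
Proof.
rewrite /min_queries; case: xgetP => [q _ //|none]; exfalso.
have ex : exists q, `[< suffices P l q >].
  by have [q hq] := suffices_ex x0 l; exists q; apply/asboolP.
case: (ex_minnP ex) => q /asboolP hq hmin; apply: (none q).
by split=> // q' hq'; apply: hmin; apply/asboolP.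
Qed.

End WellDefined.

Lemma RUP l n : 0 < n ->
  is_min_queries (predT : pred {set 'I_n}) l (RU l n).
Proof. by case: n => // n _; apply: (min_queriesP _ ord0). Qed.

Lemma RUkP l k n : 0 < k -> 0 < n ->
  is_min_queries [pred A : {set 'I_n} | #|A| <= k] l (RUk l k n).
Proof.
by move=> k0; case: n => // n _; apply: (min_queriesP _ ord0) => x /=; rewrite cards1.
Qed.

(* Main.v *)
(* Replace "lies left" by lives: a number starts with l + 1 lives and loses one
   for every answer that contradicts it, so a query A takes a life from A (NO)
   or from its complement (YES), and the game ends when at most one number is
   alive.

   Lower bound.  Moving a life from a number to one with fewer lives never hurts
   the Questioner (win_shift), so the Responder can answer NO and rebalance.  As
   each NO costs at most k lives, after (p + 1) n / k - 1 of them there are still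
   k numbers with l - p + 1 lives, which need RU (l - p) k further queries; for
   p = l there are even k + ((l + 1) n mod k) numbers alive.

   Upper bound.  The Questioner asks about k numbers with the most lives until he
   hears YES and then repeats that query: either the NOs catch up, and all numbers
   have lost lives at a rate better than that of a run of NOs, or everything
   outside the query dies and an unrestricted game on k numbers remains.

   Exact value.  For large n the second alternative is cheap, because
   RU i k <= log k + i (K + 1) when 2 ^ K is large compared to log k and i K: find
   a candidate by bisection, repeat a query for it until it is refuted, and bisect
   again on the positions at which an answer may have been a lie. *)
Require Import Defs.
From mathcomp Require Import all_boot all_order all_algebra.
From mathcomp Require Import perm zify.
From mathcomp Require Import reals exp.
Import Order.TTheory GRing.Theory Num.Theory.

Set Implicit Arguments.
Unset Strict Implicit.
Unset Printing Implicit Defensive.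

(** * The game with lives *)

Section Lives.
Variable T : finType.
Implicit Types (f g : T -> nat) (A B : {set T}) (P : pred {set T}).

Definition dec f B (x : T) : nat := f x - (x \in B).

Definition solved f : Prop := forall x y, 0 < f x -> 0 < f y -> x = y.

(** [dec f A] is the state after NO, [dec f (~: A)] the state after YES. No answer is forbidden: too
    many lies merely kill every number, and a state without live numbers is solved. *)
Fixpoint win P q f : Prop :=
  if q is q'.+1 then
    solved f \/ exists A, [/\ P A, win P q' (dec f A) & win P q' (dec f (~: A))]
  else solved f.

Lemma win_solved P q f : solved f -> win P q f.
Proof. by case: q => [|q] //=; left. Qed.

Lemma win_leq P q q' f : q <= q' -> win P q f -> win P q' f.
Proof.
elim: q q' f => [|q IH] [|q'] f //= lq; first by left.
by case=> [?|[A [PA w1 w2]]]; [left | right; exists A; split=> //; apply: IH].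
Qed.

Lemma win_ask P A q f :
  P A -> win P q (dec f A) -> win P q (dec f (~: A)) -> win P q.+1 f.
Proof. by move=> PA w1 w2; right; exists A. Qed.

Lemma win_dead P q f : (forall x, f x = 0) -> win P q f.
Proof. by move=> f0; apply: win_solved => x y; rewrite f0. Qed.

(** The Responder can make [x] and [y] together lose at most one life per query, sparing the one
    with fewer lives if the query separates them. *)
Lemma win_pair P q f x y :
  win P q f -> x != y -> 0 < f x -> 0 < f y -> f x + f y <= q.+1.
Proof.
elim: q f => [|q IH] f /=.
  by move=> sf /eqP nxy fx fy; case: nxy; apply: sf.
case=> [sf /eqP nxy fx fy|[A [_ w1 w2]] nxy fx fy].
  by case: nxy; apply: sf.
have := IH _ w1 nxy; have := IH _ w2 nxy; rewrite /dec !inE.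
by case: (x \in A); case: (y \in A) => /=; lia.
Qed.

(** Every live number stays alive after at least one of the two answers, so some branch keeps at
    least half of them. *)
Lemma win_card P q f : win P q f -> #|[set x | 0 < f x]| <= 2 ^ q.
Proof.
have sol g : solved g -> #|[set x | 0 < g x]| <= 1.
  by move=> sg; apply/card_le1_eqP => x y; rewrite !inE => gx gy; exact: sg.
elim: q f => [|q IH] f /=; first exact: sol.
case=> [/sol/leq_trans|[A [_ /IH w1 /IH w2]]]; first by apply; rewrite expn_gt0.
rewrite expnS mul2n -addnn; apply: leq_trans (leq_add w1 w2).
apply: leq_trans (leq_card_setU _ _); apply/subset_leq_card/subsetP => x.
by rewrite !inE /dec !inE; case: (x \in A); rewrite subn0 => ->; rewrite ?orbT.
Qed.

End Lives.

(** Simulation by pulling queries back along [phi]. It yields monotonicity in the lives, invariance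
    under permutations, and the passage between a [k]-subset and ['I_k] in both directions. *)
Lemma win_transport (T T' : finType) (phi : T' -> T) (D : {set T'})
    (P : pred {set T}) (P' : pred {set T'}) q f f' :
  {in D &, injective phi} ->
  (forall A, P A -> P' (D :&: phi @^-1: A)) ->
  (forall x, x \notin D -> f' x = 0) ->
  (forall x, x \in D -> f' x <= f (phi x)) ->
  win P q f -> win P' q f'.
Proof.
move=> inj PP'.
have sol g g' : (forall x, x \notin D -> g' x = 0) ->
    (forall x, x \in D -> g' x <= g (phi x)) -> solved g -> solved g'.
  move=> g0 gle sg x y gx gy.
  have xD : x \in D by apply: contraTT gx => /g0->.
  have yD : y \in D by apply: contraTT gy => /g0->.
  by apply: inj => //; apply: sg; [have := gle _ xD | have := gle _ yD]; lia.
elim: q f f' => [|q IH] f f' f0 fle /=; first exact: sol.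
case=> [sf|[A [PA w1 w2]]]; first by left; apply: sol sf.
right; exists (D :&: phi @^-1: A); split; first exact: PP'.
  apply: IH w1 => x xD; rewrite /dec ?(f0 _ xD) //.
  by rewrite !inE xD /=; have := fle _ xD; lia.
apply: IH w2 => x xD; rewrite /dec ?(f0 _ xD) //.
by rewrite !inE xD /=; have := fle _ xD; lia.
Qed.

Lemma win_mono (T : finType) (P : pred {set T}) q (f g : T -> nat) :
  (forall x, f x <= g x) -> win P q g -> win P q f.
Proof.
move=> fg; apply: (@win_transport _ _ id setT) => //.
- by move=> A; suff -> : [set: T] :&: id @^-1: A = A by []; apply/setP=> x; rewrite !inE.
- by move=> x; rewrite inE.
Qed.

Lemma strategy_win (T : finType) (P : pred {set T}) (s : strategy T) q f :
  all_queries P s -> (forall x, 0 < f x -> wins q (f x).-1 x s) -> win P q f.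
Proof.
elim: s q f => [y|A sY IHY sN IHN] q f /=.
  by case: q => [|q] _ H; apply: win_solved => x z /H /eqP <- /H /eqP <-.
move=> /and3P[PA aY aN]; case: q => [|q] H.
  by apply: win_dead => x; apply/eqP; rewrite -leqn0 leqNgt; apply/negP => /H.
apply: (win_ask PA); [apply: IHN => // x | apply: IHY => // x];
  rewrite /dec ?inE => dx;
  have /H/andP[] : 0 < f x by apply: leq_trans dx (leq_subr _ _).
all: move: dx; case: (x \in A); rewrite ?subn0 //.
all: by case: (f x) => [|[|m]] //; rewrite subn1.
Qed.

Lemma win_strategy (T : finType) (P : pred {set T}) (x0 : T) q f :
  win P q f -> exists s, all_queries P s /\ forall x, 0 < f x -> wins q (f x).-1 x s.
Proof.
have sol q' g : solved g ->
    exists s, all_queries P s /\ forall x, 0 < g x -> wins q' (g x).-1 x s.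
  move=> sg; case: (pickP (fun x => 0 < g x)) => [y gy|g0].
    by exists (Announce y); split=> // x gx; case: q' => [|q'] /=; apply/eqP/sg.
  by exists (Announce x0); split=> // x; rewrite g0.
elim: q f => [|q IH] f; first exact: (sol 0).
case=> [|[A [PA /IH[sN [aN HN]] /IH[sY [aY HY]]]]]; first exact: (sol q.+1).
exists (Ask A sY sN); split=> [|x fx /=]; first by rewrite /= PA aY aN.
have := HN x; have := HY x; rewrite /dec !inE.
case: (x \in A); case: (f x) fx => [|[|m]] //= _; rewrite ?subn0 ?subn1 /=; last 2 first.
- by move=> _ ->.
- by move=> -> // ->.
- by move=> ->.
- by move=> -> // ->.
Qed.

Lemma sufficesE (T : finType) (P : pred {set T}) (x0 : T) l q :
  suffices P l q <-> win P q (fun=> l.+1).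
Proof.
split=> [[s [aq ws]]|/(win_strategy x0)[s [aq ws]]].
  by apply: (strategy_win aq) => x _; apply: ws.
by exists s; split=> // x; apply: ws.
Qed.

(** * Lower bounds *)

Section States.
Variable T : finType.
Implicit Types (f g : T -> nat) (A B : {set T}).

Definition shift f (x y : T) : T -> nat :=
  fun z => if z == x then (f x).+1 else if z == y then (f y).-1 else f z.

Lemma solved_single f x : (forall z, z != x -> f z = 0) -> solved f.
Proof.
move=> f0 u v fu fv; transitivity x.
  by apply/eqP; apply: contraTT fu => /f0->.
by apply/eqP; rewrite eq_sym; apply: contraTT fv => /f0->.
Qed.

(** With [F] the identity this gives conservation of the total; with [F] the square it makes
    [win_balance] terminate. *)
Lemma sum_shift (F : nat -> nat) f x y : y != x ->
  \sum_z F (shift f x y z) + F (f x) + F (f y)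
    = \sum_z F (f z) + F (f x).+1 + F (f y).-1.
Proof.
move=> yx; rewrite (bigD1 x) //= (bigD1 y) //= [in RHS](bigD1 x) //= [in RHS](bigD1 y) //=.
rewrite {1 2}/shift !eqxx (negPf yx).
rewrite (eq_bigr (fun z => F (f z))) => [|z /andP[zx zy]]; first by lia.
by rewrite /shift (negPf zx) (negPf zy).
Qed.

Definition balanced f := forall x y, f x <= (f y).+1.

Lemma sum_mem A : \sum_z (z \in A) = #|A|.
Proof. by rewrite -sum1_card [RHS]big_mkcond; apply: eq_bigr => z _; case: (z \in A). Qed.

Lemma sum_dec f A : \sum_z f z <= \sum_z dec f A z + #|A|.
Proof.
rewrite -sum_mem -big_split /=; apply: leq_sum => z _.
by rewrite /dec; case: (z \in A) => /=; lia.
Qed.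

(** Either every number exceeds [j], or some number does not and then, by balance, none exceeds
    [j + 1]; so each number above [j] contributes only one life to the surplus over [j * #|T|]. *)
Lemma balanced_level f j m :
  balanced f -> m <= #|T| -> j * #|T| + m <= \sum_z f z ->
  m <= #|[set z | j < f z]|.
Proof.
move=> bal mT le; case: (boolP [forall z, j < f z]) => [/forallP al|/forallPn[y]].
  by rewrite -cardsT in mT; apply: leq_trans mT _; apply/subset_leq_card/subsetP=> z _; rewrite inE.
rewrite -leqNgt => fy; have {}le : j * #|T| + m <= j * #|T| + #|[set z | j < f z]|.
  apply: leq_trans le _; rewrite -sum_mem mulnC -sum_nat_const.
  rewrite -big_split /=; apply: leq_sum => z _.
  by rewrite inE; have := bal z y; case: ltnP; lia.
by lia.
Qed.

End States.

Section Convexity.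
Variables (T : finType) (k : nat).
Hypothesis k_gt0 : 0 < k.
Implicit Types (f g : T -> nat) (A B : {set T}).

Local Notation query := [pred A : {set T} | #|A| <= k].

Lemma win_perm q f g (s : T -> T) :
  injective s -> (forall x, g x <= f (s x)) -> win query q f -> win query q g.
Proof.
move=> injs gf; apply: (@win_transport _ _ s setT) => // [x y _ _|A|x].
- exact: injs.
- rewrite setTI /=; apply: leq_trans.
  by rewrite on_card_preimset //; apply: onW_bij; apply: injF_bij.
- by rewrite inE.
Qed.


(** Asking [[set x]] again and again costs one of the two numbers a life each time; the bound
    matches [win_pair]. *)
Lemma win_two q f x y :
  (forall z, z != x -> z != y -> f z = 0) -> f x + f y <= q.+1 -> win query q f.
Proof.
elim: q f => [|q IH] f f0 fxy.
all: case: (posnP (f x)) => fx; first by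
  apply: win_solved; apply: (@solved_single _ _ y) => z zy;
  case: (eqVneq z x) => [->|zx] //; apply: f0.
all: case: (posnP (f y)) => fy; first by
  apply: win_solved; apply: (@solved_single _ _ x) => z zy;
  case: (eqVneq z y) => [->|zx] //; apply: f0.
  lia.
case: (eqVneq x y) => [xy|xy].
  by apply: win_solved; apply: (@solved_single _ _ x) => z zx; apply: f0; rewrite -?xy.
apply: (@win_ask _ _ [set x]); first by rewrite /= cards1.
- apply: IH => [z zx zy|]; first by rewrite /dec f0.
  by rewrite /dec !inE eqxx; lia.
- apply: IH => [z zx zy|]; first by rewrite /dec f0.
  by rewrite /dec !inE eqxx (eq_sym y) xy /=; lia.
Qed.

(** The same query serves the shifted state: shifting and answering commute up to domination, unless
    a dead [x] lies in [B]; then its new life is taken back at once and the unshifted state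
    dominates. *)
Lemma win_dec_shift q f x y B :
  (forall g, g x < g y -> g x + g y <= q.+1 -> win query q g ->
     win query q (shift g x y)) ->
  (f x).+1 < f y -> f x + f y <= q.+2 -> (0 < f x) || (f x + f y <= q.+1) ->
  win query q (dec f B) -> win query q (dec (shift f x y) B).
Proof.
move=> IH ltxy le1 le2 w.
have nxy : y != x by apply: contraTneq ltxy => ->; lia.
have eqw g : (forall z, g z <= shift (dec f B) x y z) ->
    dec f B x < dec f B y -> dec f B x + dec f B y <= q.+1 -> win query q g.
  by move=> le lt leq; apply: win_mono le _; apply: IH.
have eqm g : (forall z, g z <= dec f B z) -> win query q g.
  by move=> le; apply: win_mono w.
have sd (u v : bool) : (x \in B) = u -> (y \in B) = v ->
   (u <= f x) -> (forall z, dec (shift f x y) B z <= shift (dec f B) x y z).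
  move=> xB yB uf z; rewrite /shift /dec.
  case: eqP => [->|_]; first by rewrite xB; lia.
  by case: eqP => [->|_ //]; rewrite yB; lia.
have := @win_pair _ _ _ _ x y w; rewrite eq_sym => /(_ nxy).
case: (posnP (f x)) => fx.
  case xB: (x \in B).
    move=> _; apply: eqm => z; rewrite /shift /dec.
    case: eqP => [->|_]; first by rewrite xB fx.
    by case: eqP => [->|_ //]; lia.
  by move=> _; apply: eqw; [exact: (sd false _ xB erefl) | |];
    rewrite /dec xB; case: (y \in B); lia.
case xB: (x \in B); case yB: (y \in B) => pr; apply: eqw;
  try exact: (sd _ _ xB yB); move: pr; rewrite /dec xB yB /=; lia.
Qed.

(* Convexity: among states with the same total number of lives, balanced ones
   are easier for the Questioner.  The bound on [f x + f y] is automatic when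
   both numbers are alive and excludes reviving a dead number too late. *)
Lemma win_shift q f x y :
  f x < f y -> f x + f y <= q.+1 -> win query q f -> win query q (shift f x y).
Proof.
elim: q f x y => [|q IH] f x y ltxy le w.
all: have nxy : y != x by apply: contraTneq ltxy => ->; lia.
all: have sxx : shift f x y x = (f x).+1 by rewrite /shift eqxx.
all: have sxy : shift f x y y = (f y).-1 by rewrite /shift eqxx (negPf nxy).
all: have szz z : z != x -> z != y -> shift f x y z = f z by
  rewrite /shift => /negPf-> /negPf->.
  apply: (@win_two _ _ x y) => [z zx zy|]; last by rewrite sxx sxy; lia.
  rewrite szz //; apply/eqP; rewrite -leqn0 leqNgt.
  by apply: contra zy => fz; apply/eqP/w => //; lia.
(* When the lives differ by exactly one, the shift just exchanges [x] and [y]. *)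
case: (ltngtP (f x).+1 (f y)) ltxy => // ltxy _; last first.
  apply: (win_perm (@perm_inj _ (tperm x y))) w => z.
  case: tpermP => [->|->|/eqP zx /eqP zy]; rewrite ?sxx ?sxy ?szz //; lia.
have [/forallP dead|/forallPn[z]] :=
    boolP [forall z, (z != x) && (z != y) ==> (f z == 0)].
  apply: (@win_two _ _ x y) => [z zx zy|]; last by rewrite sxx sxy; lia.
  by rewrite szz //; apply/eqP; have := dead z; rewrite zx zy.
rewrite negb_imply -lt0n => /andP[/andP[zx zy] fz].
(* If [x] is dead, the third live number [z] bounds [f y] through [win_pair]. *)
have le2 : (0 < f x) || (f x + f y <= q.+1).
  case: posnP => //= fx0; rewrite fx0 add0n.
  have fy : 0 < f y by lia.
  by have := win_pair w zy fz fy; lia.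
case: w => [sf|[A [PA w1 w2]]].
  by case/eqP: zy; apply: sf => //; lia.
by apply: (win_ask PA); apply: win_dec_shift => //; move=> g ? ? ?; apply: IH.
Qed.

(** Shifting a life to a number with at least two fewer lowers the sum of squares. Two live numbers
    are required so that [win_pair] supplies the side condition of [win_shift]. *)
Lemma win_balance q f x y :
  x != y -> 0 < f x -> 0 < f y -> win query q f ->
  exists g, [/\ balanced g, \sum_z g z = \sum_z f z & win query q g].
Proof.
have [N] := ubnP (\sum_z f z ^ 2).
elim: N f x y => // N IH f x y; rewrite ltnS => leN xy fx fy w.
have [/forallP bal|/forallPn[u]] := boolP [forall u, forall v, f u <= (f v).+1].
  by exists f; split=> // u v; have /forallP := bal u; apply.
case/forallPn=> v; rewrite -ltnNge => ltvu.
have uv : u != v by apply: contraTneq ltvu => ->; lia.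
have le : f v + f u <= q.+1.
  case: (posnP (f v)) => fv; last by apply: (win_pair w); rewrite 1?eq_sym //; lia.
  have [z zu fz] : exists2 z, z != u & 0 < f z.
    by case: (eqVneq x u) => [xu|]; [exists y; rewrite // -xu eq_sym | exists x].
  have fu : 0 < f u by lia.
  by have := win_pair w zu fz fu; lia.
have sq := sum_shift (fun m => m ^ 2) f uv.
have sm := sum_shift id f uv; rewrite /= in sm.
have lt : \sum_z shift f v u z ^ 2 < N.
  by case: (f u) ltvu sq => [|m] //= ltvu; rewrite !expnS !expn0; nia.
have := IH _ v u lt; case.
- by rewrite eq_sym.
- by rewrite /shift eqxx.
- by rewrite /shift eqxx (negPf uv); lia.
- by apply: win_shift => //; lia.
- by move=> g [bg sg wg]; exists g; split=> //; rewrite sg; lia.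
Qed.

Hypothesis k_gt1 : 1 < k.
Hypothesis kT : k.*2 <= #|T|.

(** If all numbers are alive, the at least [k > 1] numbers outside [A] survive; if one is dead,
    every number has at most one life and [A] takes at most [k] of the [2k] lives. *)
Lemma balanced_alive f A :
  balanced f -> k.*2 <= \sum_z f z -> #|A| <= k -> 1 < #|[set z | 0 < dec f A z]|.
Proof.
move=> bal le leA; case: (boolP [forall z, 0 < f z]) => [/forallP al|/forallPn[y]].
  have leC : k <= #|~: A| by rewrite cardsCs setCK; lia.
  apply: leq_trans k_gt1 (leq_trans leC _); apply/subset_leq_card/subsetP=> z.
  by rewrite !inE /dec => /negPf->; rewrite subn0.
rewrite -leqNgt leqn0 => /eqP fy.
suff: \sum_z dec f A z <= #|[set z | 0 < dec f A z]| by have := sum_dec f A; lia.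
rewrite -sum_mem; apply: leq_sum => z _.
by rewrite inE; have := bal z y; rewrite fy /dec; case: ltnP; lia.
Qed.

Lemma win_no q f :
  balanced f -> k.*2 <= \sum_z f z -> win query q f ->
  exists q' g, [/\ q = q'.+1, balanced g, \sum_z f z <= \sum_z g z + k & win query q' g].
Proof.
move=> bal le w.
have nsol : ~ solved f.
  move=> sf; have /card_gt1P[x [y []]] : 1 < #|[set z | 0 < dec f set0 z]|.
    by apply: balanced_alive; rewrite ?cards0.
  by rewrite !inE /dec !inE !subn0 => fx fy /eqP[]; apply: sf.
case: q w => [//|q] [//|[A [PA w _]]].
have /card_gt1P[x [y []]] := balanced_alive bal le PA.
rewrite !inE => fx fy xy; have [g [bg sg wg]] := win_balance xy fx fy w.
by exists q, g; split=> //; rewrite /= in PA; have := sum_dec f A; lia.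
Qed.

(** The spare [k] in [t.+1 * k] guarantees the [2k] lives that [win_no] needs before each of the [t]
    answers. *)
Lemma win_nos t q f :
  balanced f -> t.+1 * k <= \sum_z f z -> win query q f ->
  exists q' g, [/\ q = q' + t, balanced g,
    \sum_z f z <= \sum_z g z + t * k & win query q' g].
Proof.
elim: t q f => [|t IH] q f bal le w; first by exists q, f; rewrite mul0n !addn0; split.
have le2 : k.*2 <= \sum_z f z by lia.
have [q1 [g1 [q1E bal1 s1 w1]]] := win_no bal le2 w.
have le1 : t.+1 * k <= \sum_z g1 z by lia.
have [q2 [g2 [q2E bal2 s2 w2]]] := IH _ _ bal1 le1 w1.
by exists q2, g2; split=> //; lia.
Qed.

End Convexity.

Lemma win_full (T : finType) (D : {set T}) P q f l k :
  k <= #|D| -> (forall x, x \in D -> l <= f x) -> win P q f ->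
  win (predT : pred {set 'I_k}) q (fun=> l).
Proof.
move=> kD fD; pose phi (i : 'I_k) := enum_val (widen_ord kD i).
apply: (@win_transport _ _ phi setT) => // [i j _ _ /enum_val_inj [] /val_inj //|i|i _].
- by rewrite inE.
- by apply: fD; apply: enum_valP.
Qed.

Lemma win_RU l k (k_gt0 : 0 < k) :
  win (predT : pred {set 'I_k}) (RU l k) (fun=> l.+1).
Proof. by apply/(sufficesE _ (Ordinal k_gt0)); case: (RUP l k_gt0). Qed.

Lemma RU_leq l k q (k_gt0 : 0 < k) :
  win (predT : pred {set 'I_k}) q (fun=> l.+1) -> RU l k <= q.
Proof. by move/(sufficesE _ (Ordinal k_gt0)); case: (RUP l k_gt0) => _; apply. Qed.

Lemma win_RUk l k n : 0 < k -> 0 < n ->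
  win [pred A : {set 'I_n} | #|A| <= k] (RUk l k n) (fun=> l.+1).
Proof.
by move=> k0 n0; apply/(sufficesE _ (Ordinal n0)); case: (RUkP l k0 n0).
Qed.

Lemma RUk_leq l k n q : 0 < k -> 0 < n ->
  win [pred A : {set 'I_n} | #|A| <= k] q (fun=> l.+1) -> RUk l k n <= q.
Proof.
by move=> k0 n0 /(sufficesE _ (Ordinal n0)); case: (RUkP l k0 n0) => _; apply.
Qed.

Lemma balanced_const (T : finType) m : balanced (fun _ : T => m).
Proof. by move=> x y. Qed.

(** Stopping one NO short of the quotient leaves [k] plus the remainder lives on top of [l - p] full
    layers of [n]. *)
Lemma RUk_no l k n p : 1 < k -> k.*2 <= n -> p <= l ->
  exists q (g : 'I_n -> nat), [/\ RUk l k n = q + ((p.+1 * n) %/ k - 1), balanced g,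
    (l - p) * n + (k + (p.+1 * n) %% k) <= \sum_z g z &
    win [pred A : {set 'I_n} | #|A| <= k] q g].
Proof.
move=> k1 kn pl; have k0 : 0 < k by lia.
have n0 : 0 < n by lia.
have kT : k.*2 <= #|'I_n| by rewrite card_ord.
have sm : \sum_(z < n) l.+1 = l.+1 * n by rewrite sum_nat_const card_ord mulnC.
have e := divn_eq (p.+1 * n) k.
have d0 : 0 < (p.+1 * n) %/ k by rewrite divn_gt0 //; nia.
have pn : p.+1 * n + (l - p) * n = l.+1 * n by rewrite -mulnDl; congr (_ * _); lia.
have := @win_nos _ k k0 k1 kT ((p.+1 * n) %/ k - 1) _ _ (balanced_const _).
case/(_ _ _ _ (win_RUk l k0 n0)) => [|q [g [qE bg sg wg]]].
  by rewrite sm; nia.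
by exists q, g; split=> //; rewrite sm in sg; nia.
Qed.

Lemma RUk_ge l k n p : 1 < k -> k.*2 <= n -> p <= l ->
  (p.+1 * n) %/ k - 1 + RU (l - p) k <= RUk l k n.
Proof.
move=> k1 kn pl; have [q [g [-> bg sg wg]]] := RUk_no k1 kn pl.
rewrite addnC leq_add2r; apply: (RU_leq (ltnW k1)).
apply: (@win_full _ [set z | l - p < g z] _ _ _ _ _ _ _ wg) => [|x].
  by apply: balanced_level => //; rewrite card_ord; lia.
by rewrite inE.
Qed.

Lemma RUk_ge_log l k n : 1 < k -> k.*2 <= n ->
  k + (l.+1 * n) %% k <= 2 ^ (RUk l k n - ((l.+1 * n) %/ k - 1)).
Proof.
move=> k1 kn; have [q [g [-> bg sg wg]]] := RUk_no k1 kn (leqnn l).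
rewrite subnn in sg; rewrite addnK; apply: leq_trans (win_card wg).
have := ltn_pmod (l.+1 * n) (ltnW k1) => lt.
by apply: balanced_level => //; rewrite card_ord; lia.
Qed.

(** * The unrestricted game *)

Lemma exists_subset_card (T : finType) (B : {set T}) m :
  m <= #|B| -> exists2 A : {set T}, A \subset B & #|A| = m.
Proof.
move=> mB; exists [set x in take m (enum B)].
  by apply/subsetP => x; rewrite inE => /mem_take; rewrite mem_enum.
by rewrite cardsE (card_uniqP _) ?take_uniq ?enum_uniq // size_takel -?cardE.
Qed.

(* The Questioner asks A again and again until either the numbers outside A are
   all dead or A has been answered NO d times more often than YES. *)
Lemma win_repeat (T : finType) (P : pred {set T}) (A : {set T}) q b d f :
  P A -> 0 < b + d -> (forall x, x \notin A -> f x <= b) ->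
  (forall m, m < b -> m.*2 + d <= q /\
     win P (q - (m.*2 + d)) (fun x => f x - m - (x \in A) * d)) ->
  (forall v, v < b + d -> b + v <= q /\
     win P (q - (b + v)) (fun x => (x \in A) * (f x - v))) ->
  win P q f.
Proof.
move=> PA; have [N] := ubnP (b.*2 + d).
(* NO lowers [d] by one, YES lowers [b] and raises [d] by one, so the measure drops either way. [m]
   counts the YES answers when the lead [d] is reached, [v] the NO answers when the complement
   dies. *)
elim: N q b d f => // N IH q b d f; rewrite ltnS => leN bd fb bal fin.
case: b leN bd fb bal fin => [|b] leN bd fb bal fin.
  have [_] := fin 0 bd; rewrite subn0; apply: win_mono => x.
  by case: (boolP (x \in A)) => [_|/fb]; lia.
case: d leN bd bal fin => [|d] leN bd bal fin.
  have [//|_] := bal 0; rewrite subn0; apply: win_mono => x; lia.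
case: q bal fin => [|q] bal fin; first by have [|] := fin 0.
apply: (win_ask PA).
- apply: (IH _ b.+1 d) => [||x xA|m mb|v vb]; try lia.
  + by rewrite /dec (negPf xA) subn0; apply: fb.
  + have [le w] := bal m mb; split; first lia.
    rewrite (_ : q - _ = q.+1 - (m.*2 + d.+1)); last lia.
    by apply: win_mono w => x; rewrite /dec; case: (x \in A); lia.
  + have [|le w] := fin v.+1; first lia.
    split; first lia.
    rewrite (_ : q - _ = q.+1 - (b.+1 + v.+1)); last lia.
    by apply: win_mono w => x; rewrite /dec; case: (x \in A); lia.
- apply: (IH _ b d.+2) => [||x xA|m mb|v vb]; try lia.
  + by rewrite /dec !inE xA; have := fb x xA; lia.
  + have [|le w] := bal m.+1; first lia.
    split; first lia.
    rewrite (_ : q - _ = q.+1 - (m.+1.*2 + d.+1)); last lia.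
    by apply: win_mono w => x; rewrite /dec !inE; case: (x \in A); lia.
  + have [|le w] := fin v; first lia.
    split; first lia.
    rewrite (_ : q - _ = q.+1 - (b.+1 + v)); last lia.
    by apply: win_mono w => x; rewrite /dec !inE; case: (x \in A); lia.
Qed.

Lemma win_halving (T : finType) k q f (D : {set T}) :
  (forall x, f x <= (x \in D)) -> #|D| <= 2 ^ q -> #|D| <= k.*2 ->
  win [pred A : {set T} | #|A| <= k] q f.
Proof.
elim: q f D => [|q IH] f D fD D2 Dk.
  have alive x : 0 < f x -> x \in D by have := fD x; case: (x \in D) => //=; lia.
  by move=> x y /alive xD /alive yD; move/card_le1_eqP: D2; apply.
have [|A AD cA] := @exists_subset_card _ D (#|D|./2); first by lia.
have cD := cardsID A D; have /setIidPr AE := AD; rewrite AE in cD.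
rewrite expnS in D2.
apply: (@win_ask _ _ A); first by rewrite /= cA; lia.
- apply: (IH _ (D :\: A)) => [x||]; try lia.
  by rewrite /dec !inE; have := fD x; case: (x \in A); case: (x \in D) => /=; lia.
- apply: (IH _ A) => [x||]; try lia.
  by rewrite /dec !inE; have := fD x; case: (boolP (x \in A)) => /=; case: (x \in D) => /=; lia.
Qed.

Section UnrestrictedGame.
Variable T : finType.
Implicit Types (f g : T -> nat) (A B : {set T}).

(** The levels of [f] are disjoint, so halves chosen separately in each unite to one query that
    halves them all up to rounding. *)
Lemma level_halves f : exists A, forall B, B \in [set A; ~: A] ->
  forall j, (#|[set x in B | f x == j]|.*2 <= (#|[set x | f x == j]|).+1).
Proof.
have hE (L : {set T}) : exists A : {set T}, (A \subset L) && (#|A| == #|L|./2).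
  have [|A AL /eqP cA] := @exists_subset_card _ L (#|L|./2); first by lia.
  by exists A; rewrite AL.
pose h L := xchoose (hE L).
have hP L : h L \subset L /\ #|h L| = #|L|./2.
  by have /andP[? /eqP] := xchooseP (hE L).
pose L j := [set x | f x == j].
exists [set x | x \in h (L (f x))] => B BA j.
have [hs hc] := hP (L j).
have E1 : [set x in [set x | x \in h (L (f x))] | f x == j] = h (L j).
  apply/setP => x; rewrite !inE; apply/andP/idP => [[xh /eqP <-//]|xh].
  by have := subsetP hs x xh; rewrite inE => /eqP fx; rewrite fx eqxx.
have E2 : [set x in ~: [set x | x \in h (L (f x))] | f x == j] = L j :\: h (L j).
  by apply/setP => x; rewrite !inE; case: eqP => [->|_]; rewrite ?andbT ?andbF.
have := cardsID (h (L j)) (L j); rewrite (setIidPr hs) => cE.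
by move: BA; rewrite !inE => /orP[]/eqP->; rewrite ?E1 ?E2 -/(L j); lia.
Qed.

(* After M bisection queries at most 'C(M, d) <= M ^ d numbers are left that
   contradict exactly d answers; 2 ^ s is what s further bisections will remove. *)
Definition levels f i M s :=
  (forall x, f x <= i.+1) /\
  forall d, d <= i -> #|[set x | f x == i.+1 - d]| <= 2 ^ s * M ^ d.

(** The new level [d + 1] is half of the old one plus half of the old level [d]. The bounds carry a
    factor [2 ^ s.+1], hence are even, and rounding costs nothing. *)
Lemma levels_halved f i M s : levels f i M s.+1 ->
  exists A, levels (dec f A) i M.+1 s /\ levels (dec f (~: A)) i M.+1 s.
Proof.
move=> [fi fL]; have [A HA] := level_halves f; exists A.
suff H B : B \in [set A; ~: A] -> levels (dec f B) i M.+1 s.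
  by split; apply: H; rewrite !inE eqxx ?orbT.
move=> BA; split=> [x|d di]; first by have := fi x; rewrite /dec; lia.
have BA' : ~: B \in [set A; ~: A].
  by move: BA; rewrite !inE => /orP[]/eqP->; rewrite ?setCK eqxx ?orbT.
have h1 := HA _ BA' (i.+1 - d); have := fL d di.
case: d di h1 => [|d] di h1 h2.
  rewrite expn0 in h2 *; rewrite expnS in h2.
  have : #|[set x | dec f B x == i.+1 - 0]| <= #|[set x in ~: B | f x == i.+1 - 0]|.
    apply/subset_leq_card/subsetP => x; rewrite !inE /dec; have := fi x.
    by case: (x \in B) => /=; lia.
  lia.
have h3 := HA _ BA (i.+1 - d); have h4 : d <= i by lia.
have {}h4 := fL d h4.
have h5 : #|[set x | dec f B x == i.+1 - d.+1]| <=
    #|[set x in ~: B | f x == i.+1 - d.+1] :|: [set x in B | f x == i.+1 - d]|.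
  apply/subset_leq_card/subsetP => x; rewrite !inE /dec.
  by case: (x \in B) => /=; lia.
have [+ _] := leq_card_setU [set x in ~: B | f x == i.+1 - d.+1]
  [set x in B | f x == i.+1 - d].
have h6 : M ^ d + M ^ d.+1 <= M.+1 ^ d.+1.
  by rewrite !expnS -mulSn leq_pmul2l //; case: (d) => // e; rewrite leq_exp2r.
have := leq_mul (leqnn (2 ^ s)) h6; rewrite mulnDr.
move: h1 h2 h3 h4 h5; rewrite [2 ^ s.+1]expnS -!mulnA; lia.
Qed.

Lemma levels_win q f i M s : levels f i M s ->
  (forall g, levels g i (M + s) 0 -> win predT q g) -> win predT (s + q) f.
Proof.
elim: s f M => [|s IH] f M fL H; first by apply: H; rewrite addn0.
have [A [h1 h2]] := levels_halved fL.
by rewrite addSn; apply: (@win_ask _ _ A) => //; apply: IH (h1) _ || apply: IH (h2) _;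
  move=> g; rewrite addSnnS; apply: H.
Qed.

(** At most one candidate has [i + 1] lives. Repeating it confirms it, or refutes it with [m] YES
    and [m + 1] NO; then [K] bisections separate the at most [M + 1 <= 2 ^ K] numbers now on top.
    The condition on [K] persists because [M] grows by [K] while [i] drops. *)
Lemma levels_finish K i M f : 0 < K -> M.+1 + i * K <= 2 ^ K + K ->
  levels f i M 0 -> win predT (i * K.+1) f.
Proof.
move=> K0; have [N] := ubnP i; elim: N i M f => // N IH i M f.
rewrite ltnS => leN leK [fi fL].
have := fL 0 isT; rewrite subn0 expn0 => top.
case: i leN leK fi fL top => [|i] leN leK fi fL top.
  have one x : 0 < f x -> x \in [set x | f x == 1] by rewrite inE; have := fi x; lia.
  by apply: win_solved => x y /one fx /one fy; move/card_le1_eqP: top; apply.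
have iK : i.+1 * K.+1 = K.+1 + i * K.+1 by rewrite mulSn.
pose A := [set x | f x == i.+2].
apply: (@win_repeat _ _ A _ i.+1 1) => //.
- by move=> x; rewrite inE; have := fi x; lia.
- move=> m mi.
  have mE : i * K.+1 = m * K.+1 + (i - m) * K.+1 by rewrite -mulnDl; congr (_ * _); lia.
  have mK : i * K = m * K + (i - m) * K by rewrite -mulnDl; congr (_ * _); lia.
  have mM : m <= m * K by rewrite leq_pmulr.
  split; first by lia.
  apply: (@win_leq _ _ (K + (i - m) * K.+1)); first by lia.
  apply: (@levels_win _ _ (i - m) M) => [|g gL]; last by apply: IH gL; lia.
  split=> [x|d di].
    by have := fi x; case: (boolP (x \in A)); rewrite inE; lia.
  (* The new level [d] is the old level [d + 1], joined for [d = 0] by the refuted candidate. *)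
  have sub : [set x | f x - m - (x \in A) * 1 == (i - m).+1 - d] \subset
      [set x | f x == i.+2 - d.+1] :|: (if d == 0 then A else set0).
    apply/subsetP => x; case: (boolP (x \in A)) => xA.
      rewrite !inE; move: (xA); rewrite inE => /eqP ->; case: d di => [|d] di /=.
        by rewrite xA orbT.
      lia.
    by move: xA; rewrite !inE; case: d di => [|d] di; lia.
  apply: leq_trans (subset_leq_card sub) _.
  have [+ _] := leq_card_setU [set x | f x == i.+2 - d.+1] (if d == 0 then A else set0).
  move/leq_trans; apply.
  have := fL d.+1; rewrite ltnS expn0 mul1n => fd.
  have {}fd := fd (leq_trans di (leq_subr _ _)).
  case: d di fd {sub} => [|d] di fd /=.
    by rewrite expn0 muln1; rewrite expn1 in fd; have : #|A| <= 1 by []; lia.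
  rewrite cards0 addn0; apply: leq_trans fd _; rewrite expnS leq_mul //; lia.
- move=> v vi; split; first by nia.
  apply: win_solved => x y fx fy; move/card_le1_eqP: top => top.
  have inA z : 0 < (z \in A) * (f z - v) -> z \in A by case: (z \in A).
  by apply: top; apply: inA.
Qed.

End UnrestrictedGame.

Lemma RU_upper c K i k : 0 < k -> 0 < K -> k <= 2 ^ c -> c.+1 + i * K <= 2 ^ K + K ->
  RU i k <= c + i * K.+1.
Proof.
(* The [c] bisections start from [M = 0]: as [0 ^ 0 = 1], all [k] numbers fit into the top level,
   and the lower levels are empty. *)
move=> k0 K0 kc cK; apply: (RU_leq k0); apply: (@levels_win _ _ _ i 0) => [|g].
  split=> // -[|d] di; first by
    rewrite expn0 muln1; apply: leq_trans kc; rewrite -[X in _ <= X]card_ord max_card.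
  rewrite (_ : [set x | _] = set0) ?cards0 //; apply/setP=> x; rewrite !inE; lia.
by rewrite add0n; apply: levels_finish.
Qed.

(** * Upper bounds *)

Section Cyclic.
(** [G j r] bounds the cost of a state with [r] numbers at [j + 1] lives and the others at [j];
    [Rb i] that of [k] numbers with [i + 1] lives. The hypotheses let [G] pay for a NO inside a
    level or across two, for the loss of one life by all in two queries, for the final bisection,
    and for a run that kills the complement. *)
Variables (T : finType) (k l : nat) (Rb : nat -> nat) (G : nat -> nat -> nat).
Implicit Types (f : T -> nat) (A B : {set T}).

Local Notation query := [pred A : {set T} | #|A| <= k].

Hypothesis k_gt0 : 0 < k.
Hypothesis kT : k.*2 <= #|T|.
Hypothesis RbP : forall i A f, i <= l -> #|A| = k ->
  (forall x, f x <= (x \in A) * i.+1) -> win query (Rb i) f.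
Hypothesis G_no : forall j r, j <= l -> k <= r <= #|T| -> (0 < j) || (k.*2 <= r) ->
  G j (r - k) < G j r.
Hypothesis G_no_wrap : forall j r, j < l -> r < k -> G j (#|T| + r - k) < G j.+1 r.
Hypothesis G_level : forall j r, j < l -> r <= #|T| -> G j r + 2 <= G j.+1 r.
Hypothesis G_base : forall r, r < k.*2 -> r <= 2 ^ G 0 r.
Hypothesis G_yes : forall j r v, j <= l -> v <= j -> k <= r <= #|T| ->
  (0 < j) || (k.*2 <= r) -> (j + v + Rb (j - v)).+1 <= G j r.
Hypothesis G_yes_wrap : forall j r v, j <= l -> v < j -> r < k ->
  j + v + Rb (j - v) <= G j r.

Lemma G_levels j m r : m <= j -> j <= l -> r <= #|T| -> G (j - m) r + m.*2 <= G j r.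
Proof.
elim: m => [|m IH] mj jl rT; first by rewrite subn0 addn0.
have := @G_level (j - m.+1) r; have := IH (ltnW mj) jl rT.
rewrite (_ : (j - m.+1).+1 = j - m); lia.
Qed.

(* In a balanced state the Questioner asks about k numbers with the most lives;
   after a first YES he repeats this query. *)
Lemma win_cyclic j B q :
  j <= l -> G j #|B| <= q -> win query q (fun x => j + (x \in B)).
Proof.
have [N] := ubnP (j * #|T| + #|B|).
elim: N j B q => // N IH j B q; rewrite ltnS => leN jl Gq.
have BT : #|B| <= #|T| by apply: max_card.
have T0 : 0 < #|T| by lia.
case: (boolP ((0 < j) || (k.*2 <= #|B|))) => [big|]; last first.
  rewrite negb_or -eqn0Ngt -ltnNge => /andP[/eqP j0 small]; subst j.
  apply: (@win_halving _ _ _ _ B) => //; last exact: ltnW.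
  by apply: leq_trans (G_base small) _; rewrite leq_exp2l.
have down m : m < j -> (j - m.+1) * #|T| + #|T| <= j * #|T|.
  by move=> mj; rewrite -mulSnr leq_mul2r; lia.
case: (leqP k #|B|) => kB.
  have [A AB cA] := exists_subset_card kB.
  have kBT : k <= #|B| <= #|T| by rewrite kB BT.
  case: q Gq => [|q] Gq; first by have := G_yes jl (leq0n j) kBT big; lia.
  have inAB x : x \in A -> x \in B by apply: (subsetP AB).
  apply: (@win_ask _ _ A); first by rewrite /= cA.
    have cBA : #|B :\: A| = #|B| - k by rewrite cardsD (setIidPr AB) cA.
    apply: (@win_mono _ _ _ _ (fun x => j + (x \in B :\: A))) => [x|].
      by rewrite /dec !inE; case: (boolP (x \in A)) => [/inAB ->|] /=; lia.
    apply: IH => //; rewrite cBA; first by lia.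
    by have := G_no jl kBT big; lia.
  (* The first YES has already been given, hence [d = 1]: once the NOs have caught up, every number
     has lost exactly [m + 1] lives. *)
  apply: (@win_repeat _ _ A _ j 1) => [||x xA|m mj|v vj].
  - by rewrite /= cA.
  - by lia.
  - by rewrite /dec !inE xA /=; lia.
  - have Gm := G_levels mj jl BT; split; first by lia.
    apply: (@win_mono _ _ _ _ (fun x => j - m.+1 + (x \in B))) => [x|].
      by rewrite /dec !inE; case: (x \in A); lia.
    by apply: IH; have := down m mj; lia.
  - have vj' : v <= j by lia.
    have Gv := G_yes jl vj' kBT big; split; first by lia.
    apply: (@win_leq _ _ (Rb (j - v))); first by lia.
    apply: (RbP _ cA) => [|x]; first by lia.
    by rewrite /dec !inE; case: (x \in A) => /=; lia.
case: j leN jl Gq big down => [|j] leN jl Gq big down; first by lia.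
(* Too few numbers are on top, so the query is filled up with [C] from the level below; after NO the
   top level is the complement of [C]. *)
have [|C CB cC] := @exists_subset_card _ (~: B) (k - #|B|).
  by rewrite [#|~: B|]cardsCs setCK; lia.
have dBC x : x \in C -> x \notin B by move/(subsetP CB); rewrite inE.
pose A := B :|: C.
have cA : #|A| = k.
  rewrite cardsU cC (_ : B :&: C = set0) ?cards0; first by lia.
  by apply/setP => x; rewrite !inE; case: (boolP (x \in C)) => [/dBC/negPf->|]; rewrite ?andbF.
case: q Gq => [|q] Gq; first by have := G_yes_wrap jl (ltn0Sn j) kB; lia.
apply: (@win_ask _ _ A); first by rewrite /= cA.
  have cC' : #|~: C| = #|T| + #|B| - k by rewrite [LHS]cardsCs setCK; lia.
  apply: (@win_mono _ _ _ _ (fun x => j + (x \in ~: C))) => [x|].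
    by rewrite /dec /A !inE; case: (boolP (x \in C)) => [/dBC/negPf->|];
      case: (x \in B) => /=; lia.
  apply: IH => //; rewrite ?cC'; [by lia|by lia|].
  by have := G_no_wrap jl kB; lia.
apply: (@win_repeat _ _ A _ j 1) => [||x xA|m mj|v vj].
- by rewrite /= cA.
- by lia.
- by move: xA; rewrite /dec /A !inE; case: (x \in B); case: (x \in C) => //=; lia.
- have mj' : m < j.+1 by lia.
  have Gm := G_levels mj' jl BT; split; first by lia.
  apply: (@win_mono _ _ _ _ (fun x => j.+1 - m.+1 + (x \in B))) => [x|].
    by rewrite /dec /A !inE; case: (x \in B); case: (x \in C) => /=; lia.
  by apply: IH; have := down m mj'; lia.
- have {}vj : v < j.+1 by lia.
  have Gv := G_yes_wrap jl vj kB; split; first by lia.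
  apply: (@win_leq _ _ (Rb (j.+1 - v))); first by lia.
  apply: (RbP _ cA) => [|x]; first by lia.
  by rewrite /dec /A !inE; case: (x \in B); case: (x \in C) => /=; lia.
Qed.

End Cyclic.

Lemma win_RU_on (T : finType) k i (A : {set T}) f : 0 < k -> #|A| = k ->
  (forall x, f x <= (x \in A) * i.+1) ->
  win [pred A : {set T} | #|A| <= k] (RU i k) f.
Proof.
move=> k0 cA fA; have /card_gt0P[x0 x0A] : 0 < #|A| by rewrite cA.
pose phi x := cast_ord cA (enum_rank_in x0A x).
apply: (@win_transport _ _ phi A _ _ _ _ f) (win_RU i k0).
- by move=> x y xA yA /cast_ord_inj/enum_rank_in_inj; apply.
- by move=> B _ /=; rewrite -[X in _ <= X]cA subset_leq_card ?subsetIl.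
- by move=> x xA; have := fA x; rewrite (negPf xA); lia.
- by move=> x xA; have := fA x; rewrite xA mul1n.
Qed.

Lemma bigmax_addn_leq j (F : nat -> nat) c m :
  (forall i, i < j.+1 -> F i + c <= m) -> \max_(i < j.+1) F i + c <= m.
Proof.
move=> H; have cm : c <= m by have := H 0 isT; lia.
rewrite -(subnK cm) leq_add2r; apply/bigmax_leqP => i _.
by have := H i (ltn_ord i); lia.
Qed.

Lemma leq_bigmax_nat j (F : nat -> nat) i : i < j.+1 -> F i <= \max_(i < j.+1) F i.
Proof. by move=> ij; apply: (leq_bigmax (Ordinal ij)). Qed.

Lemma RUk_le_max l k n : 1 < k -> k.*2 <= n ->
  RUk l k n <= \max_(i < l.+1) (((l - i) * n + n) %/ k + RU i k + l).
Proof.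
move=> k1 kn; have k0 := ltnW k1; have n0 : 0 < n by lia.
(* [i] is the number of lies left when a game on [k] numbers starts; the quotient counts the NOs,
   and [l] absorbs the summand [j <= l] of [G_yes]. *)
pose t j r i := ((j - i) * n + r) %/ k + RU i k + l.
pose G j r := \max_(i < j.+1) t j r i.
have divS a : k <= a -> (a - k) %/ k + 1 = a %/ k.
  by move=> ka; rewrite -[in RHS](subnK ka) divnDr ?dvdnn // divnn k0.
have Gge j r i : i <= j -> ((j - i) * n + r) %/ k + RU i k + l <= G j r.
  by move=> ij; apply: (@leq_bigmax_nat _ (t j r)).
have n2 a : (a + n) %/ k >= a %/ k + 2.
  by rewrite leq_divRL // mulnDl; have := leq_trunc_div a k; lia.
apply: (RUk_leq k0 n0).
apply: (@win_mono _ _ _ _ (fun x => l + (x \in [set: 'I_n]))) => [x|].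
  by rewrite inE; lia.
apply: (@win_cyclic _ k l (fun i => RU i k) G) => //; rewrite ?cardsT ?card_ord //.
- by move=> i A f _; apply: win_RU_on.
- move=> j r jl /andP[kr rn] _; rewrite -addn1;
  apply: (@bigmax_addn_leq j (t j _) _ _) => i ij; rewrite /t.
  have := divS ((j - i) * n + r) (leq_trans kr (leq_addl _ _)).
  by have := Gge j r i ij; rewrite addnBA //; lia.
- move=> j r jl rk; rewrite -addn1;
  apply: (@bigmax_addn_leq j (t j _) _ _) => i ij; rewrite /t.
  have ij' : i <= j.+1 by lia.
  have kr : k <= (j - i) * n + (n + r) by apply: leq_trans (leq_addl _ _); lia.
  have := Gge j.+1 r i ij'; rewrite (@subSn i j ij) mulSnr -(addnA ((j - i) * n)).
  by have := divS _ kr; rewrite addnBA; lia.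
- move=> j r jl rn;
  apply: (@bigmax_addn_leq j (t j _) _ _) => i ij; rewrite /t.
  have ij' : i <= j.+1 by lia.
  have := Gge j.+1 r i ij'; rewrite (@subSn i j ij) mulSnr (addnAC ((j - i) * n)).
  by have := n2 ((j - i) * n + r); lia.
- move=> r rk; have kR : k <= 2 ^ RU 0 k.
    have := win_card (win_RU 0 k0).
    have -> : [set x : 'I_k | 0 < 1] = setT by apply/setP => x; rewrite !inE.
    by rewrite cardsT card_ord.
  have := Gge 0 r 0 isT; rewrite mul0n add0n => le.
  apply: leq_trans (leq_pexp2l (isT : 0 < 2) le).
  case: (leqP k r) => kr.
    apply: leq_trans (_ : 2 ^ (RU 0 k).+1 <= _); first by rewrite expnS; lia.
    have : 0 < r %/ k by rewrite divn_gt0.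
    by rewrite leq_exp2l //; lia.
  apply: leq_trans (ltnW kr) (leq_trans kR _).
  by rewrite leq_exp2l // addnAC leq_addl.
- move=> j r v jl vj /andP[kr rn] _; have := Gge j r (j - v) (leq_subr _ _); rewrite (subKn vj).
  suff : v.*2.+1 <= (v * n + r) %/ k by lia.
  by rewrite leq_divRL //; nia.
- move=> j r v jl vj rk; have := Gge j r (j - v) (leq_subr _ _); rewrite (subKn (ltnW vj)).
  suff : v.*2 <= (v * n + r) %/ k by lia.
  by rewrite leq_divRL //; nia.
Qed.

Lemma up_log2_addn k m : 0 < k -> m < k -> up_log 2 (k + m) <= (up_log 2 k).+1.
Proof.
move=> k0 mk; apply: up_log_min => //; rewrite expnS.
by have := up_logP k (isT : 1 < 2); lia.
Qed.

Lemma square_leq_exp2 m : (m + 2) * (m - 1) <= 2 * 2 ^ m.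
Proof.
elim: m => [|[|[|[|m]]] IH] //; rewrite expnS.
by move: (2 ^ m.+3) IH => X; rewrite !subn1 /=; lia.
Qed.

Lemma RUk_le_log l k n K :
  1 < k -> (K + 3) * k <= n -> l.+1 < K -> up_log 2 k <= 2 ^ (K - 2) ->
  RUk l k n <= (l.+1 * n) %/ k - 1 + up_log 2 (k + (l.+1 * n) %% k).
Proof.
move=> k1 Kn lK cK; have k0 := ltnW k1; have n0 : 0 < n by lia.
set c := up_log 2 k in cK.
have kc : k <= 2 ^ c by apply: up_logP.
have c0 : 0 < c by rewrite lt0n; apply: contraTneq kc => ->; rewrite -ltnNge.
have RUc i : i <= l -> RU i k <= c + i * K.+1.
  move=> il; apply: RU_upper => //; first by lia.
  (* Of the four copies of [2 ^ (K - 2)], two pay for [K * (K - 3)] and two for [c + 1]. *)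
  have KE : 2 ^ K = 4 * 2 ^ (K - 2) by rewrite -[4]/(2 ^ 2) -expnD; congr (_ ^ _); lia.
  have K2 : K * (K - 3) <= 2 * 2 ^ (K - 2).
    have -> : K - 3 = K - 2 - 1 by lia.
    have {1}-> : K = K - 2 + 2 by lia.
    exact: square_leq_exp2.
  by nia.
(* The claimed value for [j * n + r] lives in total: a NO removes [k] of them, so it lowers the
   quotient by one and keeps the remainder. *)
pose G j r := (j * n + r) %/ k - 1 + up_log 2 (k + (j * n + r) %% k).
have divS a : k <= a -> a %/ k = ((a - k) %/ k).+1 /\ a %% k = (a - k) %% k.
  move=> ka; rewrite -{1 3}(subnK ka) divnDr ?dvdnn // divnn k0 addn1.
  by rewrite modnDr.
have Gc j r : (j * n + r) %/ k - 1 + c <= G j r.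
  by rewrite leq_add2l; apply: leq_up_log; apply: leq_addr.
(* Each layer of [n] lives adds [K + 3] to the quotient: [K + 1] for a lie in [RU_upper] and two for
   answers to the repeated query. *)
have div_n a : a %/ k + (K + 3) <= (a + n) %/ k.
  by rewrite leq_divRL // mulnDl; have := leq_trunc_div a k; lia.
have div_ge j r : j * (K + 3) <= (j * n + r) %/ k.
  by rewrite leq_divRL //; nia.
have jK j : j * (K + 3) = j * K.+1 + j.*2 by rewrite addn3 -addn2 mulnDr muln2 //.
have vK v : v <= v * K.+1 by apply: leq_pmulr.
have kn : k.*2 <= n by nia.
have G_sub a : k.*2 <= a -> (a - k) %/ k - 1 + up_log 2 (k + (a - k) %% k)
    < a %/ k - 1 + up_log 2 (k + a %% k).
  move=> ka; have [|-> ->] := divS a; first by lia.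
  have : 0 < (a - k) %/ k by rewrite divn_gt0 //; lia.
  by lia.
apply: (RUk_leq k0 n0).
apply: (@win_mono _ _ _ _ (fun x => l + (x \in [set: 'I_n]))) => [x|].
  by rewrite inE; lia.
apply: (@win_cyclic _ k l (fun i => RU i k) G) => //; rewrite ?cardsT ?card_ord //.
- by move=> i A f _; apply: win_RU_on.
- move=> j r jl /andP[kr rn] big; rewrite /G addnBA //; apply: G_sub.
  by case: j jl big => [|j] jl big; nia.
- move=> j r jl rk; rewrite /G (_ : j * n + _ = j.+1 * n + r - k); last by nia.
  by apply: G_sub; nia.
- move=> j r jl rn; apply: leq_trans (Gc _ _).
  have := up_log2_addn k0 (ltn_pmod (j * n + r) k0).
  rewrite /G -/c mulSnr (addnAC (j * n)); have := div_n (j * n + r).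
  by move: (_ %/ k) (_ %/ k) => X Y; lia.
- move=> r rk; rewrite /G mul0n add0n.
  apply: leq_trans (_ : 2 ^ up_log 2 (k + r %% k) <= _); last by rewrite leq_exp2l ?leq_addl.
  apply: leq_trans (up_logP _ _) => //.
  case: (leqP k r) => kr; last by rewrite modn_small //; lia.
  by have [_ ->] := divS r kr; rewrite modn_small; lia.
- move=> j r v jl vj /andP[kr rn] big; apply: leq_trans (Gc _ _).
  have jv : j - v <= l by lia.
  have := RUc _ jv; case: j jl vj big jv => [|j] jl vj big jv.
    have : 2 <= r %/ k by rewrite leq_divRL //; lia.
    by move: vj; rewrite leqn0 => /eqP ->; rewrite !mul0n !add0n; move: (_ %/ k) => X; lia.
  have [|-> _] := divS (j.+1 * n + r); first by lia.
  rewrite -addnBA //.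
  have := div_ge j.+1 (r - k); rewrite jK.
  have := vK v; have : (j.+1 - v) * K.+1 + v * K.+1 = j.+1 * K.+1.
    by rewrite -mulnDl subnK.
  move: (_ %/ k) (RU _ _) (_ * K.+1) (v * K.+1) (j.+1 * K.+1) => X1 X2 X3 X4 X5.
  by lia.
- move=> j r v jl vj rk; apply: leq_trans (Gc _ _).
  have jv : j - v <= l by lia.
  have := RUc _ jv; have := div_ge j r; rewrite jK.
  have := vK v; have : (j - v) * K.+1 + v * K.+1 = j * K.+1.
    by rewrite -mulnDl subnK // ltnW.
  move: (_ %/ k) (RU _ _) (_ * K.+1) (v * K.+1) (j * K.+1) => X1 X2 X3 X4 X5.
  by lia.
- by rewrite /G -mulSnr.
Qed.

(** * Real binary logarithms and [up_log] *)

Section BinaryLogarithm.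
Variable R : realType.
Local Open Scope ring_scope.

Lemma ln2_gt0 : 0 < ln 2 :> R.
Proof. by rewrite ln_gt0 // ltr1n. Qed.

Lemma log2_lt_nat (x : R) (m : nat) : 0 < x -> (log2 x < m%:R) = (x < 2 ^+ m).
Proof.
move=> x0; have ln2 := ln2_gt0.
rewrite /log2 ltr_pdivrMr // mulr_natl -lnXn // ltr_ln // posrE.
by rewrite exprn_gt0.
Qed.

Lemma nat_lt_log2 (x : R) (m : nat) : 0 < x -> (m%:R < log2 x) = (2 ^+ m < x).
Proof.
move=> x0; have ln2 := ln2_gt0.
rewrite /log2 ltr_pdivlMr // mulr_natl -lnXn // ltr_ln // posrE.
by rewrite exprn_gt0.
Qed.

Lemma ceil_log2 (s : nat) : (1 < s)%N -> Num.ceil (log2 s%:R : R) = up_log 2 s.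
Proof.
move=> s1; have s0 : 0 < s%:R :> R by rewrite ltr0n ltnW.
have u0 : (0 < up_log 2 s)%N by rewrite up_log_gt0.
have /andP[lo hi] := up_log_bounds (isT : (1 < 2)%N) s1.
apply: ceil_def; apply/andP; split; last first.
  by rewrite -pmulrn leNgt nat_lt_log2 // -natrX ltr_nat -leqNgt.
rewrite (_ : (up_log 2 s)%:Z - 1 = (up_log 2 s).-1%:Z); last by lia.
by rewrite -pmulrn nat_lt_log2 // -natrX ltr_nat.
Qed.

(** The factor 2 absorbs the rounding: [2 ^ up_log 2 k < 2 * k], so [up_log 2 k] lies strictly below
    [log2 (2 * k)]. *)
Lemma up_log2_lt_exp (k m : nat) : (0 < k)%N ->
  log2 (log2 (2 * k%:R)) < m%:R :> R -> (up_log 2 k < 2 ^ m)%N.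
Proof.
move=> k0; have kR : 0 < 2 * k%:R :> R by rewrite mulr_gt0 // ltr0n.
have log_gt : (up_log 2 k)%:R < log2 (2 * k%:R) :> R.
  rewrite nat_lt_log2 // -natrX -natrM ltr_nat.
  case: (leqP k 1) => k1; first by rewrite (_ : k = 1%N) //; lia.
  have /andP[lo _] := up_log_bounds (isT : (1 < 2)%N) k1.
  have u0 : (0 < up_log 2 k)%N by rewrite up_log_gt0.
  by rewrite -(prednK u0) expnS; lia.
rewrite log2_lt_nat; last by apply: le_lt_trans log_gt.
by rewrite -natrX => /(lt_trans log_gt); rewrite ltr_nat.
Qed.

End BinaryLogarithm.

Theorem theorem4 (R : realType) (l k n : nat)
    (hk1 : 1 < k) (hkn : k < n %/ 2) :
  (Lbound l k n <= RUk l k n <= Lbound l k n + l + 1)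
  /\
  (1 <= l ->
   (Num.max (k * (l + 5))%:R
      (Num.max (k%:R * (log2 (log2 (2 * k%:R)) + 6))
               (k%:R * (log2 (log2 (2 * k%:R)) + 2 * log2 l%:R + 5)))
    <= n%:R :> R)%R ->
   ((RUk l k n)%:Z
    = (((l + 1) * n) %/ k)%:Z - 1
      + Num.ceil (log2 (k + ((l + 1) * n) %% k)%:R : R))%R).
Proof.
have k0 := ltnW hk1; have kn : k.*2 <= n by lia.
split.
  apply/andP; split.
    by apply/bigmax_leqP => p _; apply: RUk_ge => //; rewrite -ltnS.
  apply: leq_trans (RUk_le_max l hk1 kn) _; apply/bigmax_leqP => i _.
  (* The two maxima match term by term under [p = l - i]. *)
  have il : l - i < l.+1 by lia.
  have := @leq_bigmax_nat l (fun p => (p.+1 * n) %/ k - 1 + RU (l - p) k) _ il.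
  rewrite -/(Lbound l k n) mulSnr subKn -1?ltnS //.
  have : 0 < ((l - i) * n + n) %/ k.
    by rewrite divn_gt0 //; apply: leq_trans (leq_addl _ _); lia.
  by lia.
move=> l1; rewrite ge_max => /andP[nl]; rewrite ge_max => /andP[nlog _].
rewrite addn1 ceil_log2; last by lia.
have Nl : l + 5 <= n %/ k by rewrite leq_divRL // mulnC -(ler_nat R).
(* [RUk_le_log] is applied with [K = n %/ k - 3]: [l + 5] gives [l.+1 < K], and the summand 6 puts
   the iterated logarithm below [n %/ k - 5 = K - 2]. *)
have cK : up_log 2 k <= 2 ^ (n %/ k - 3 - 2).
  apply/ltnW/(@up_log2_lt_exp R) => //.
  have : (n%:R < k%:R * (n %/ k).+1%:R :> R)%R.
    by rewrite -natrM ltr_nat mulnC ltn_ceil.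
  move/(le_lt_trans nlog); rewrite ltr_pM2l ?ltr0n // => lt.
  rewrite -(ltrD2r 6%:R); apply: lt_le_trans lt _.
  by rewrite -natrD ler_nat; lia.
have upper : RUk l k n <= (l.+1 * n) %/ k - 1 + up_log 2 (k + (l.+1 * n) %% k).
  apply: RUk_le_log cK => //; last by lia.
  by rewrite -leq_divRL //; lia.
have lower : up_log 2 (k + (l.+1 * n) %% k) <= RUk l k n - ((l.+1 * n) %/ k - 1).
  by apply: up_log_min => //; apply: RUk_ge_log.
(* This bound and the positive quotient ensure that neither natural subtraction truncates, so the
   equation carries over to the integers. *)
have ge := RUk_ge hk1 kn (leqnn l).
have : 0 < (l.+1 * n) %/ k by rewrite divn_gt0 //; nia.
move: (_ %/ k) (up_log _ _) upper lower ge => X u upper lower ge X0.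
by lia.
Qed.
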